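(* Let $A \in \mathbb{R}^{n \times n}$, let $\lambda \in \mathbb{R}$ be a simple eigenvalue of $A$, and let $x \in \mathbb{R}^n$ be an eigenvector, $Ax = \lambda x$, with $x_i \neq 0$ for all $1 \le i \le n$. Let $\varepsilon \in \{-1,1\}^n$ be defined by $x_i = \varepsilon_i |x_i|$. Let $D$ be the diagonal matrix with $D_{ii} = |x_i|$, let $B = D^{-1} A D$ (so $B_{ij} = a_{ij}|x_j|/|x_i|$), and let $C = B - \lambda \,\mathrm{Id}_{n\times n}$, with rows $c_1,\dots,c_n$; thus $C\varepsilon = 0$. Consider the following randomized iteration (Algorithm 1): start with $0 \neq y_0 \in \mathbb{R}^n$; given $y_k$, choose an index $i \in \{1,\dots,n\}$ at random, independently of the past, with $\mathbb{P}(i=j) = \|c_j\|^2 / \sum_{\ell=1}^n \|c_\ell\|^2$, and set $$y_{k+1} = y_k - \left\langle y_k, \frac{c_i}{\|c_i\|}\right\rangle \frac{c_i}{\|c_i\|}.$$ Let $S = S_k = \{1 \le i \le n : \mathrm{sign}((y_k)_i) \neq \varepsilon_i\}$. Denote by $\sigma_1(C) \ge \dots \ge \sigma_n(C)$ the singular values of $C$ and by $\|C\|_F$ its Frobenius norm. If $\sigma_{n-1}(C) > 0$, then for all $k \in \mathbb{N}$, $$\mathbb{E}\left[\min\{\#S, n - \#S\}\cdot \|y_k\|^2\right] \le n \left(1 - \frac{\sigma_{n-1}(C)^2}{\|C\|_F^2}\right)^k \|y_0\|^2.$$ Moreover, if $y_0$ is chosen uniformly at random from a sphere of radius $\|y_0\|$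 centered at the origin (independently of the index choices), then for all $k \in \mathbb{N}$, $\mathbb{E}\,\|y_k\|^2 \ge \|y_0\|^2/n$.
   Context: $\mathrm{sign}(t)$ denotes the sign of a real number $t$ (with $\mathrm{sign}(0)=0$). Throughout, the solution of $Cy=0$ is assumed unique up to scaling, i.e. the null space of $C$ is spanned by $\varepsilon$; the sign vector $\varepsilon$ is fixed as one of the two admissible choices $\pm\varepsilon$. Rows $c_j$ with $c_j = 0$ are chosen with probability zero. *)

(* Defs.v *)
From HB Require Import structures.
From mathcomp Require Import all_boot all_order all_algebra.
From mathcomp Require Import all_classical all_reals all_analysis.

Set Implicit Arguments.
Unset Strict Implicit.
Unset Printing Implicit Defensive.

Import Order.TTheory GRing.Theory Num.Theory.
Local Open Scope classical_set_scope.
Local Open Scope ring_scope.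

Section Defs.
Variable R : realType.
Variable n : nat.

Definition dotv (u v : 'rV[R]_n) : R := \sum_(i < n) u 0 i * v 0 i.
Definition sqnorm (u : 'rV[R]_n) : R := dotv u u.
Definition normv (u : 'rV[R]_n) : R := Num.sqrt (sqnorm u).

Definition frob2 (M : 'M[R]_n) : R := \sum_(i < n) \sum_(j < n) M i j ^+ 2.

Definition epsv (x : 'cV[R]_n) : 'rV[R]_n := \row_i Num.sg (x i 0).
Definition Dmat (x : 'cV[R]_n) : 'M[R]_n := diag_mx (\row_i `|x i 0|).
Definition Bmat (A : 'M[R]_n) (x : 'cV[R]_n) : 'M[R]_n :=
  invmx (Dmat x) *m A *m Dmat x.
Definition Cmat (A : 'M[R]_n) (lam : R) (x : 'cV[R]_n) : 'M[R]_n :=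
  Bmat A x - lam%:M.

Definition is_singular_values (M : 'M[R]_n) (sv : seq R) : Prop :=
  [/\ size sv = n, sorted (fun a b => b <= a) sv, all (fun s => 0 <= s) sv &
      char_poly (M^T *m M) = \prod_(s <- sv) ('X - (s ^+ 2)%:P)].

Definition kstep (c : 'rV[R]_n) (y : 'rV[R]_n) : 'rV[R]_n :=
  let u := (normv c)^-1 *: c in y - dotv y u *: u.

Definition iterates (C : 'M[R]_n) (y0 : 'rV[R]_n) (s : seq 'I_n) : 'rV[R]_n :=
  foldl (fun y i => kstep (row i C) y) y0 s.

Definition pidx (C : 'M[R]_n) (j : 'I_n) : R := sqnorm (row j C) / frob2 C.

Definition Eidx (C : 'M[R]_n) (y0 : 'rV[R]_n) (k : nat) (f : 'rV[R]_n -> R) : R :=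
  \sum_(t : k.-tuple 'I_n) (\prod_(i <- t) pidx C i) * f (iterates C y0 t).

Definition Sset (eps y : 'rV[R]_n) : {set 'I_n} :=
  [set i | Num.sg (y 0 i) != eps 0 i].

Definition orthogonal_mx (Q : 'M[R]_n) : Prop := Q *m Q^T = 1%:M.

End Defs.

(* Y0 : T -> R^n is a random vector uniformly distributed on the sphere of
   radius r: each coordinate is measurable, Y0 takes values on the sphere,
   and its law is invariant under all orthogonal transformations (tested on
   measurable boxes, which generate the Borel sigma-algebra of R^n). *)
Definition uniform_on_sphere (R : realType) (n : nat) (d : measure_display)
  (T : measurableType d) (P : probability T R) (r : R) (Y0 : T -> 'rV[R]_n) : Prop :=
  [/\ (forall i : 'I_n, measurable_fun setT (fun w => Y0 w 0 i)),
      (forall w, normv (Y0 w) = r) &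
      (forall (Q : 'M[R]_n) (B : 'I_n -> set R), orthogonal_mx Q ->
         (forall i, measurable (B i)) ->
         P [set w : T | forall i : 'I_n, B i ((Y0 w *m Q) 0 i)] =
         P [set w : T | forall i : 'I_n, B i (Y0 w 0 i)])].

(* Main.v *)
(** Every projection preserves [<y, e>] since [C e = 0], and one step changes
    [E |y|^2] by [- |C y|^2 / |C|_F^2].  Hence the defect
    [n |y|^2 - <y, e>^2], which is [n] times the squared norm of the component of
    [y] orthogonal to [e], contracts in mean by [1 - sigma_(n-1)^2 / |C|_F^2], because
    [sigma_(n-1)^2] bounds [C^T C] from below on the orthogonal complement of [e].
    The defect dominates [min(#S, n - #S) |y|^2] by Cauchy-Schwarz over [S] or its
    complement.  For the lower bound, [|y_k|^2 >= <y_k, u>^2 = <y_0, u>^2] with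
    [u = e / |e|], and by rotation invariance [<y_0, u>] has the same law as each
    coordinate of [y_0], so its second moment is [r^2 / n].  Simplicity of [lam] is
    what rules out [C = 0], where the index probabilities would degenerate to 0. *)

Require Import Defs.
From HB Require Import structures.
From mathcomp Require Import all_boot all_order all_algebra.
From mathcomp Require Import all_classical all_reals all_analysis.
From mathcomp Require Import measurable_realfun spectral complex ring lra.

Set Implicit Arguments.
Unset Strict Implicit.
Unset Printing Implicit Defensive.

Import Order.TTheory GRing.Theory Num.Theory.
Local Open Scope ring_scope.

(** * Characteristic polynomials and sorted sequences *)

Lemma char_poly_conj (F : fieldType) (n : nat) (P A : 'M[F]_n) :
  P \in unitmx -> char_poly (invmx P *m A *m P) = char_poly A.
Proof.
move=> Pu; rewrite /char_poly /char_poly_mx.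
have PP : map_mx polyC (invmx P) *m map_mx polyC P = 1%:M.
  by rewrite -map_mxM mulVmx // map_mx1.
have -> : 'X%:M - map_mx polyC (invmx P *m A *m P) =
    map_mx polyC (invmx P) *m ('X%:M - map_mx polyC A) *m map_mx polyC P.
  rewrite mulmxBr mulmxBl !map_mxM /= scalar_mxC.
  by rewrite -[X in _ = X - _]mulmxA PP mulmx1.
by rewrite !det_mulmx mulrAC -det_mulmx PP det1 mul1r.
Qed.

(** The zero-based index [m] is the last but one place, so every entry up to it is at least its
    value and only the final entry can be smaller. *)
Lemma count_lt_nth_sorted (R : realDomainType) (s : seq R) (m : nat) :
  size s = m.+2 -> sorted (fun a b => b <= a) s ->
  (count (fun t => t < s`_m)%R s <= 1)%N.
Proof.
move=> sz so; rewrite -{2}(cat_take_drop m.+1 s) count_cat.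
have -> : count (fun t => t < s`_m) (take m.+1 s) = 0%N.
  apply/eqP; rewrite -leqn0 leqNgt -has_count; apply/hasPn => t tin.
  have [i ltim <-] := nthP (0 : R) tin.
  rewrite size_take sz ltnSn in ltim; rewrite -leNgt nth_take //.
  have tr : transitive (fun a b : R => b <= a).
    by move=> a b c ab bc; apply: le_trans bc ab.
  have := sorted_leq_nth tr (@lexx _ R) 0 so; apply.
  - by rewrite inE sz; apply: leq_trans ltim _.
  - by rewrite inE sz.
  - by rewrite -ltnS.
by rewrite add0n (leq_trans (count_size _ _)) // size_drop sz subSnn.
Qed.

(** * Spectral lower bound for a real symmetric matrix *)

Section SpectralBound.
Variables (R : realType) (m : nat).
Local Notation n := m.+2.
Implicit Types (M : 'M[R]_n) (e y : 'rV[R]_n).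
Local Open Scope sesquilinear_scope.
Local Notation toC := (map_mx (real_complex R)).

Lemma real_complex_conj p q (A : 'M[R]_(p, q)) : (toC A)^t* = toC A^T.
Proof.
apply/matrixP => i j; rewrite !mxE.
by apply/eqP; rewrite eq_complex /= oppr0 !eqxx.
Qed.

(* Diagonalize M by a unitary matrix over R[i]: as [s`_m > 0], only one eigenvalue lies
   below [s`_m], so [e] spans its eigenline and the other eigencoordinates of [e] vanish. *)
Lemma sym_second_eigenvalue_bound M (s : seq R) e y :
  M^T = M -> char_poly M = \prod_(a <- s) ('X - a%:P) ->
  size s = n -> sorted (fun a b => b <= a) s -> 0 < s`_m ->
  e *m M = 0 -> e != 0 ->
  s`_m * (sqnorm e * sqnorm y - dotv y e ^+ 2)
  <= sqnorm e * (y *m M *m y^T) 0 0.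
Proof.
move=> Msym chM sz so a0 eM e0; set a := s`_m in a0 *.
(* A real symmetric matrix is normal over [R[i]], hence unitarily diagonalizable there. *)
have /orthomx_spectralP ME : toC M \is normalmx.
  apply/normalmxP; rewrite real_complex_conj Msym //.
set P := spectralmx (toC M) in ME; set d := spectral_diag (toC M) in ME.
have Pun : P \is unitarymx := spectral_unitarymx _.
have PPt : P *m P^t* = 1%:M by apply/unitarymxP.
have PtP : P^t* *m P = 1%:M by apply: mulmx1C.
rewrite invmx_unitary // in ME.
(* Coordinates of [v] in the eigenbasis formed by the rows of [P]. *)
pose c (v : 'rV[R]_n) := toC v *m P^t*.
have cP v : toC v = c v *m P by rewrite /c -mulmxA PtP mulmx1.
have dotE u v : (real_complex R (dotv u v)) = \sum_j c u 0 j * (c v 0 j)^*.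
  transitivity ((toC u *m (toC v)^t*) 0 0).
    rewrite real_complex_conj -map_mxM mxE; congr (real_complex R _).
    by rewrite mxE; apply: eq_bigr => i _; rewrite mxE.
  rewrite [X in X *m _]cP [X in _ *m X^t*]cP trmx_mul map_mxM /=.
  rewrite mulmxA -(mulmxA (c u)) PPt mulmx1 mxE.
  by apply: eq_bigr => i _; rewrite !mxE.
have quadE : real_complex R ((y *m M *m y^T) 0 0) = \sum_j d 0 j * `|c y 0 j| ^+ 2.
  transitivity ((toC y *m toC M *m (toC y)^t*) 0 0).
    by rewrite real_complex_conj -!map_mxM [RHS]mxE.
  rewrite [X in X *m _ *m _]cP [X in _ *m X^t*]cP trmx_mul map_mxM /= ME.
  rewrite !mulmxA -(mulmxA (c y)) PPt mulmx1 -(mulmxA (c y *m _)) PPt mulmx1 mxE.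
  apply: eq_bigr => i _; rewrite mul_mx_diag !mxE normCK.
  by rewrite mulrAC mulrC.
have ced j : c e 0 j * d 0 j = 0.
  have : toC (e *m M) *m P^t* = 0 by rewrite eM map_mx0 mul0mx.
  rewrite map_mxM cP ME !mulmxA -(mulmxA (c e)) PPt mulmx1.
  rewrite -(mulmxA (c e *m _)) PPt mulmx1 mul_mx_diag.
  by move/matrixP/(_ 0 j); rewrite !mxE.
have [i0 ci0] : exists i0, c e 0 i0 != 0.
  apply/existsP; apply: contraNT e0 => /existsPn H.
  have ce0 : c e = 0.
    apply/rowP => j; rewrite [RHS]mxE; apply/eqP.
    by rewrite -[_ == _]negbK H.
  have := cP e; rewrite ce0 mul0mx => /eqP.
  by rewrite map_mx_eq0.
have di0 : d 0 i0 = 0.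
  by move/eqP: (ced i0); rewrite mulf_eq0 (negPf ci0) => /eqP.
(* Both families are the roots of the characteristic polynomial of [M], counted with
   multiplicity. *)
have dperm : perm_eq [seq d 0 i | i <- enum 'I_n] [seq real_complex R t | t <- s].
  apply: prod_XsubC_eq; rewrite big_map big_enum big_map /=.
  have := congr1 (map_poly (real_complex R)) chM.
  rewrite map_char_poly ME -invmx_unitary // char_poly_conj; last exact: spectral_unit.
  rewrite char_poly_trig ?diag_mx_is_trig // rmorph_prod => chE.
  transitivity (\prod_(i < n) ('X - (diag_mx d i i)%:P)).
    by apply: eq_bigr => i _; rewrite mxE eqxx mulr1n.
  by rewrite chE; apply: eq_bigr => t _; rewrite rmorphB /= map_polyX map_polyC.
have dge j : j != i0 -> real_complex R a <= d 0 j.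
  move=> ji0.
  (* The order on [R[i]] is partial, so [p] negates [<=]. A failure at [j] would give two places,
     [i0] and [j], counted by [p]. *)
  pose p (z : R[i]) := ~~ (real_complex R a <= z).
  have : (count p [seq d 0%R i | i <- enum 'I_n] <= 1)%N.
    rewrite (permP dperm) count_map.
    rewrite (eq_count (a2 := fun t => t < a)).
      exact: count_lt_nth_sorted.
    by move=> t /=; rewrite /p lecR -ltNge.
  rewrite count_map -size_filter => cnt.
  apply: contraLR cnt => nle; rewrite -ltnNge.
  have sub : {subset [:: i0; j] <= [seq x <- enum 'I_n | p (d 0 x)]}.
    move=> i; rewrite !inE mem_filter mem_enum andbT => /orP[] /eqP -> /=.
      by rewrite /p di0 (_ : 0 = real_complex R 0) // lecR -ltNge.
    exact: nle.
  apply: (uniq_leq_size _ sub).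
  by rewrite /= inE eq_sym ji0.
have ce0 j : j != i0 -> c e 0 j = 0.
  move=> /dge dj; move/eqP: (ced j); rewrite mulf_eq0 => /orP[/eqP //|/eqP d0].
  by move: dj; rewrite d0 (_ : 0 = real_complex R 0) // lecR leNgt a0.
have sqE : real_complex R (sqnorm e) = `|c e 0 i0| ^+ 2.
  rewrite /sqnorm dotE (bigD1 i0) //= big1 ?addr0 ?normCK // => j ji0.
  by rewrite ce0 // mul0r.
have yeE : real_complex R (dotv y e ^+ 2) = `|c e 0 i0| ^+ 2 * `|c y 0 i0| ^+ 2.
  have -> : dotv y e ^+ 2 = `|dotv y e| ^+ 2 by rewrite real_normK ?num_real.
  have nE : real_complex R `|dotv y e| = `|real_complex R (dotv y e)|.
    by rewrite normc_def /= expr0n addr0 sqrtr_sqr.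
  rewrite rmorphXn /= nE dotE (bigD1 i0) //= big1 ?addr0.
    by rewrite normrM norm_conjC exprMn mulrC.
  by move=> j ji0; rewrite ce0 // conjC0 mulr0.
(* In eigencoordinates the [i0] term cancels on the left and vanishes on the right; the others are
   compared one by one through [dge]. *)
rewrite -lecR !rmorphM rmorphB rmorphM /= yeE sqE quadE /sqnorm dotE.
rewrite -mulrBr mulrCA ler_wpM2l ?exprn_ge0 ?normr_ge0 //.
rewrite (bigD1 i0) //= -normCK addrAC subrr add0r.
rewrite [leRHS](bigD1 i0) //= di0 mul0r add0r mulr_sumr ler_sum // => j ji0.
by rewrite -normCK ler_wpM2r ?exprn_ge0 ?normr_ge0 // dge.
Qed.

End SpectralBound.

(** * Inner products and a single projection step *)

Section Dot.
Variables (R : realType) (n : nat).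
Implicit Types (u v w y c e : 'rV[R]_n).

Lemma dotvC u v : dotv u v = dotv v u.
Proof. by apply: eq_bigr => i _; rewrite mulrC. Qed.

Lemma dotvBl u v w : dotv (u - v) w = dotv u w - dotv v w.
Proof.
by rewrite /dotv -sumrB; apply: eq_bigr => i _; rewrite !mxE mulrBl.
Qed.

Lemma dotvZl a u v : dotv (a *: u) v = a * dotv u v.
Proof. by rewrite /dotv mulr_sumr; apply: eq_bigr => i _; rewrite !mxE mulrA. Qed.

Lemma sqnorm_ge0 u : 0 <= sqnorm u.
Proof. by apply: sumr_ge0 => i _; rewrite -expr2 sqr_ge0. Qed.

Lemma sqnorm_eq0 u : (sqnorm u == 0) = (u == 0).
Proof.
apply/idP/eqP => [|->]; last first.
  by rewrite /sqnorm /dotv big1 // => i _; rewrite mxE mul0r.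
rewrite psumr_eq0 => [/allP H|i _]; last by rewrite -expr2 sqr_ge0.
apply/rowP => i; rewrite mxE; apply/eqP.
by have := H i (mem_index_enum i); rewrite -expr2 sqrf_eq0.
Qed.

Lemma normv_sqr u : normv u ^+ 2 = sqnorm u.
Proof. by rewrite sqr_sqrtr ?sqnorm_ge0. Qed.

(** A form free of square roots; for [c = 0] both sides reduce to [y]. *)
Lemma kstepE c y : kstep c y = y - (dotv y c / sqnorm c) *: c.
Proof.
rewrite /kstep dotvC dotvZl scalerA -normv_sqr dotvC; congr (_ - _ *: _).
by rewrite -exprVn expr2; ring.
Qed.

Lemma dotv_kstep c e y : dotv c e = 0 -> dotv (kstep c y) e = dotv y e.
Proof. by move=> ce; rewrite kstepE dotvBl dotvZl ce mulr0 subr0. Qed.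

Lemma sqnorm_kstep c y : sqnorm (kstep c y) = sqnorm y - dotv y c ^+ 2 / sqnorm c.
Proof.
rewrite kstepE /sqnorm dotvBl dotvZl dotvC dotvBl dotvZl (dotvC c (_ - _)).
rewrite dotvBl dotvZl (dotvC c y) -/(sqnorm c) -/(sqnorm y).
have [->|c0] := eqVneq (sqnorm c) 0; first by rewrite invr0; ring.
by field.
Qed.

(** The probability weight cancels the squared row norm in the decrease of [sqnorm]; a zero row
    contributes 0 to both sides. *)
Lemma pidx_mul_defect (C : 'M[R]_n) y i :
  pidx C i * (dotv y (row i C) ^+ 2 / sqnorm (row i C)) =
  dotv y (row i C) ^+ 2 / frob2 C.
Proof.
rewrite /pidx; have [c0|c0] := eqVneq (sqnorm (row i C)) 0.
  move/eqP: c0; rewrite sqnorm_eq0 => /eqP ->.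
  by rewrite dotvC /dotv big1 ?expr0n /= ?mul0r ?mulr0 // => j _; rewrite mxE mul0r.
by rewrite -[RHS](mulfK c0); ring.
Qed.

Lemma frob2E (C : 'M[R]_n) : frob2 C = \sum_i sqnorm (row i C).
Proof.
apply: eq_bigr => i _; apply: eq_bigr => j _; by rewrite mxE expr2.
Qed.

Lemma frob2_ge0 (C : 'M[R]_n) : 0 <= frob2 C.
Proof. by rewrite frob2E sumr_ge0 // => i _; apply: sqnorm_ge0. Qed.

Lemma frob2_eq0 (C : 'M[R]_n) : (frob2 C == 0) = (C == 0).
Proof.
apply/idP/eqP => [|->]; last first.
  by rewrite /frob2 big1 // => i _; rewrite big1 // => j _; rewrite mxE expr0n.
rewrite frob2E psumr_eq0 => [/allP H|i _]; last exact: sqnorm_ge0.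
apply/row_matrixP => i; rewrite row0; apply/eqP.
by rewrite -sqnorm_eq0; apply: (implyP (H i _)); rewrite ?mem_index_enum.
Qed.

Lemma pidx_ge0 (C : 'M[R]_n) i : 0 <= pidx C i.
Proof. by rewrite divr_ge0 ?sqnorm_ge0 ?frob2_ge0. Qed.

Lemma sum_pidx (C : 'M[R]_n) : C != 0 -> \sum_i pidx C i = 1.
Proof. by move=> C0; rewrite -mulr_suml -frob2E divff // frob2_eq0. Qed.

Lemma sum_kstep_sqnorm (C : 'M[R]_n) y : C != 0 ->
  \sum_i pidx C i * sqnorm (kstep (row i C) y) =
  sqnorm y - sqnorm (y *m C^T) / frob2 C.
Proof.
move=> C0; under eq_bigr => i _ do
  rewrite sqnorm_kstep mulrBr pidx_mul_defect.
rewrite sumrB -mulr_suml sum_pidx // mul1r -mulr_suml; congr (_ - _ / _).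
apply: eq_bigr => i _; rewrite expr2; suff -> : (y *m C^T) 0 i = dotv y (row i C) by [].
by rewrite mxE; apply: eq_bigr => j _; rewrite !mxE.
Qed.

Lemma CauchySchwarz_on (A : {pred 'I_n}) u v :
  (\sum_(i in A) u 0 i * v 0 i) ^+ 2 <=
  (\sum_(i in A) u 0 i ^+ 2) * (\sum_(i in A) v 0 i ^+ 2).
Proof.
set p := \sum_(i in A) _ * _; set a := \sum_(i in A) _; set b := \sum_(i in A) _.
have ge0 t1 t2 : 0 <= t1 ^+ 2 * a - t1 * t2 * p *+ 2 + t2 ^+ 2 * b.
  have -> : t1 ^+ 2 * a - t1 * t2 * p *+ 2 + t2 ^+ 2 * b =
      \sum_(i in A) (t1 * u 0 i - t2 * v 0 i) ^+ 2.
    rewrite /a /b /p !mulr_sumr -sumrMnl -sumrB -big_split /=.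
    by apply: eq_bigr => i _; ring.
  by apply: sumr_ge0 => i _; rewrite sqr_ge0.
have a0 : 0 <= a by apply: sumr_ge0 => i _; rewrite sqr_ge0.
(* For [a = 0], the coefficients [b + 1] and [p] give [0 <= - p ^+ 2 * (b + 2)], which forces
   [p = 0]. *)
have [az|an] := eqVneq a 0.
  have H := ge0 (b + 1) p; rewrite az in H *.
  have b0 : 0 <= b by apply: sumr_ge0 => i _; rewrite sqr_ge0.
  by nra.
have {}a0 : 0 < a by rewrite lt_neqAle eq_sym an.
(* These coefficients turn the quadratic form into [a] times the Cauchy-Schwarz gap. *)
have := ge0 p a.
have -> : p ^+ 2 * a - p * a * p *+ 2 + a ^+ 2 * b = a * (a * b - p ^+ 2) by ring.
by rewrite pmulr_rge0 // subr_ge0.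
Qed.

Lemma dotv_sqr_le u v : dotv u v ^+ 2 <= sqnorm u * sqnorm v.
Proof.
have := CauchySchwarz_on predT u v; rewrite /sqnorm /dotv.
by under [X in X * _]eq_bigr do rewrite expr2;
   under [X in _ * X]eq_bigr do rewrite expr2.
Qed.

End Dot.

(** * Sign vectors and the set of sign mismatches *)

Section Signs.
Variables (R : realType) (n : nat) (e : 'rV[R]_n).
Hypothesis e_sg : forall i, e 0 i ^+ 2 = 1.

Lemma sqnorm_signs : sqnorm e = n%:R.
Proof.
rewrite /sqnorm /dotv; under eq_bigr => i _ do rewrite -expr2 e_sg.
by rewrite sumr_const card_ord.
Qed.

Lemma mem_SsetN_ge0 (y : 'rV[R]_n) i : i \notin Sset e y -> 0 <= y 0 i * e 0 i.
Proof.
rewrite inE negbK => /eqP <-; by rewrite mulrC -normrEsg.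
Qed.

Lemma mem_Sset_le0 (y : 'rV[R]_n) i : i \in Sset e y -> y 0 i * e 0 i <= 0.
Proof.
rewrite inE => H.
have /orP[/eqP e1|/eqP e1] : (e 0 i == 1) || (e 0 i == -1).
  by rewrite -sqrf_eq1 e_sg.
- rewrite e1 mulr1 leNgt; apply: contra H => y0.
  by rewrite gtr0_sg // e1.
- rewrite e1 mulrN1 oppr_le0 leNgt; apply: contra H => y0.
  by rewrite ltr0_sg // e1.
Qed.

(* If [<y, e>] is nonnegative, the terms of the sum with index in S only lower it,
   so Cauchy-Schwarz on the complement of S applies; otherwise exchange the two sets. *)
Lemma min_Sset_le (y : 'rV[R]_n) :
  (minn #|Sset e y| (n - #|Sset e y|))%:R * sqnorm y <=
  n%:R * sqnorm y - dotv y e ^+ 2.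
Proof.
set S := Sset e y.
have sumS (A : {set 'I_n}) : (\sum_(i in A) y 0 i * e 0 i) ^+ 2 <= #|A|%:R * sqnorm y.
  have := CauchySchwarz_on (mem A) y e; move/le_trans; apply; rewrite mulrC.
  under eq_bigr => i _ do rewrite e_sg.
  rewrite sumr_const ler_wpM2l ?ler0n // /sqnorm /dotv.
  rewrite [leRHS](bigID (mem A)) /=.
  under [X in _ <= X + _]eq_bigr => i _ do rewrite -expr2.
  by rewrite lerDl sumr_ge0 // => i _; rewrite -expr2 sqr_ge0.
have dE : dotv y e = \sum_(i in S) y 0 i * e 0 i + \sum_(i in ~: S) y 0 i * e 0 i.
  rewrite /dotv (bigID (mem S)) /=; congr (_ + _).
  by apply: eq_bigl => i; rewrite finset.in_setC.
have neg : \sum_(i in S) y 0 i * e 0 i <= 0.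
  by apply: sumr_le0 => i; apply: mem_Sset_le0.
have pos : 0 <= \sum_(i in ~: S) y 0 i * e 0 i.
  by apply: sumr_ge0 => i; rewrite inE; apply: mem_SsetN_ge0.
have cS := sumS S; have cN := sumS (~: S).
have cardE : (#|S| + #|~: S| = n)%N by rewrite cardsC card_ord.
have cN' : (n - #|S| = #|~: S|)%N by rewrite -[X in (X - _)%N]cardE addKn.
rewrite cN'; have y0 := sqnorm_ge0 y.
have nE : n%:R = #|S|%:R + #|~: S|%:R :> R by rewrite -natrD cardE.
rewrite nE dE.
move: neg pos cS cN; set p := \sum_(i in S) _; set q := \sum_(i in ~: S) _ => neg pos cS cN.
have [pq|pq] := leP 0 (p + q).
- have le1 : (minn #|S| #|~: S|)%:R <= #|S|%:R :> R by rewrite ler_nat geq_minl.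
  apply: (le_trans (ler_wpM2r y0 le1)).
  (* As [p <= 0 <= p + q], the sum lies between 0 and [q]. *)
  have : (p + q) ^+ 2 <= q ^+ 2 by nra.
  lra.
- have le1 : (minn #|S| #|~: S|)%:R <= #|~: S|%:R :> R by rewrite ler_nat geq_minr.
  apply: (le_trans (ler_wpM2r y0 le1)).
  have : (p + q) ^+ 2 <= p ^+ 2 by nra.
  lra.
Qed.

End Signs.

(** * Expectation over index sequences *)

Section Expectation.
Variables (R : realType) (n : nat) (C : 'M[R]_n).
Implicit Types (y e : 'rV[R]_n) (f g : 'rV[R]_n -> R).

Lemma Eidx0 y f : Eidx C y 0 f = f y.
Proof.
rewrite /Eidx (bigD1 [tuple]) //= big_nil mul1r big1 ?addr0 // => t.
by rewrite tuple0.
Qed.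

(** Conditioning on the first index: a nonempty tuple is a head and a tail, and the product of
    weights splits accordingly. *)
Lemma EidxS y k f :
  Eidx C y k.+1 f = \sum_i pidx C i * Eidx C (kstep (row i C) y) k f.
Proof.
rewrite /Eidx.
rewrite (reindex (fun p : 'I_n * k.-tuple 'I_n => [tuple of p.1 :: p.2])) /=; last first.
  exists (fun t : k.+1.-tuple 'I_n => (thead t, [tuple of behead t])).
    by move=> [i t] _; rewrite /= theadE; congr (_, _); apply: val_inj.
  by move=> t _ /=; rewrite [RHS]tuple_eta; apply: val_inj.
rewrite -(pair_bigA _ (fun i (t : k.-tuple 'I_n) =>
  (\prod_(j <- i :: t) pidx C j) * f (iterates C y (i :: t)))) /=.
apply: eq_bigr => i _; rewrite mulr_sumr; apply: eq_bigr => t _.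
by rewrite big_cons mulrA.
Qed.

Lemma Eidx_mono y k f g : (forall z, f z <= g z) -> Eidx C y k f <= Eidx C y k g.
Proof.
move=> fg; apply: ler_sum => t _; rewrite ler_wpM2l // prodr_ge0 // => i _.
exact: pidx_ge0.
Qed.

(** Splitting off the first index moves the starting point, so the induction on [k] keeps [y]
    general; the one-step bound at [y] supplies the last factor. *)
Lemma Eidx_contract f rho : 0 <= rho ->
  (forall z, \sum_i pidx C i * f (kstep (row i C) z) <= rho * f z) ->
  forall k y, Eidx C y k f <= rho ^+ k * f y.
Proof.
move=> rho0 H; elim=> [|k IH] y; first by rewrite Eidx0 mul1r.
rewrite EidxS exprSr -mulrA (le_trans _ (ler_wpM2l (exprn_ge0 k rho0) (H y))) //.
rewrite mulr_sumr ler_sum // => i _; rewrite mulrCA ler_wpM2l ?pidx_ge0 //.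
Qed.

(** When [C != 0] the weights sum to 1, so averaging leaves a conserved quantity unchanged. *)
Lemma Eidx_invariant f k y : C != 0 ->
  (forall i z, f (kstep (row i C) z) = f z) -> Eidx C y k f = f y.
Proof.
move=> C0 H; elim: k y => [|k IH] y; first exact: Eidx0.
rewrite EidxS; under eq_bigr => i _ do rewrite IH H.
by rewrite -mulr_suml sum_pidx // mul1r.
Qed.

End Expectation.

(** * Householder reflections *)

Section Reflection.
Variables (R : realType) (n : nat).
Implicit Types (u v y : 'rV[R]_n).

(** Reflection in the hyperplane orthogonal to [v]; the identity when [v = 0]. *)
Definition reflection v : 'M[R]_n := 1%:M - (2 / sqnorm v) *: (v^T *m v).

Lemma mul_reflection v y i :
  (y *m reflection v) 0 i = y 0 i - 2 / sqnorm v * dotv y v * v 0 i.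
Proof.
rewrite mulmxBr mulmx1 -scalemxAr mulmxA !mxE -!mulrA; congr (_ - _ * (_ * _)).
rewrite big_ord1 mxE; congr (_ * _).
by apply: eq_bigr => j _; rewrite mxE.
Qed.

Lemma reflection_orthogonal v : orthogonal_mx (reflection v).
Proof.
rewrite /orthogonal_mx.
have -> : (reflection v)^T = reflection v.
  by rewrite /reflection linearB /= trmx1 linearZ /= trmx_mul trmxK.
have vv : v *m v^T = (sqnorm v)%:M.
  rewrite [LHS]mx11_scalar mxE; congr (_%:M).
  by apply: eq_bigr => j _; rewrite mxE.
rewrite {2}/reflection mulmxBr mulmx1 -scalemxAr /reflection.
rewrite mulmxBl mul1mx -scalemxAl mulmxA -(mulmxA v^T) vv.
rewrite mul_mx_scalar -scalemxAl scalerBr !scalerA.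
set a := 2 / sqnorm v.
(* With this coefficient the quadratic term in [v^T *m v] cancels the two linear ones. *)
have -> : a * (a * sqnorm v) = 2 * a.
  rewrite /a; have [->|v0] := eqVneq (sqnorm v) 0; first by rewrite invr0 !mulr0.
  by field.
move: a (v^T *m v) => a V; apply/matrixP => i j; rewrite !mxE; ring.
Qed.

(* The reflection exchanging [u] with the [i]-th basis vector. *)
Lemma exists_orthogonal_col u i : sqnorm u = 1 ->
  exists2 Q : 'M[R]_n, orthogonal_mx Q & forall y, (y *m Q) 0 i = dotv y u.
Proof.
move=> u1; pose v := u - delta_mx 0 i.
have dotd y : dotv y (delta_mx 0 i) = y 0 i.
  rewrite /dotv (bigD1 i) //= big1 => [|j ji]; last by rewrite mxE (negPf ji) andbF mulr0.
  by rewrite mxE !eqxx mulr1 addr0.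
have dotvv y : dotv y v = dotv y u - y 0 i.
  by rewrite dotvC dotvBl dotvC [dotv (delta_mx _ _) _]dotvC dotd.
have vE : sqnorm v = 2 - 2 * u 0 i.
  rewrite /sqnorm dotvv dotvBl -/(sqnorm u) u1 dotvC dotd !mxE !eqxx /=; ring.
exists (reflection v); first exact: reflection_orthogonal.
move=> y; rewrite mul_reflection dotvv.
(* If [v = 0], then [u] is already the basis vector. *)
have [v0|v0] := eqVneq (sqnorm v) 0.
  rewrite v0 invr0 mulr0 !mul0r subr0 -dotd.
  by move/eqP: v0; rewrite sqnorm_eq0 subr_eq0 => /eqP ->.
have vi : v 0 i = - (sqnorm v / 2) by rewrite vE !mxE !eqxx /=; field.
by rewrite vi; field.
Qed.

End Reflection.

(** * Measurability and second moments on the sphere *)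

Section Sphere.
Local Open Scope classical_set_scope.
Local Open Scope ereal_scope.
Variables (R : realType) (d : measure_display) (T : measurableType d).

Lemma measurable_dotv n (Y : T -> 'rV[R]_n) (c : 'rV[R]_n) :
  (forall i, measurable_fun setT (fun w => Y w ord0 i)) ->
  measurable_fun setT (fun w => dotv (Y w) c).
Proof.
move=> mY; apply: measurable_sum => i; apply: measurable_funM => //.
Qed.

Lemma measurable_kstep n (Y : T -> 'rV[R]_n) (c : 'rV[R]_n) :
  (forall i, measurable_fun setT (fun w => Y w ord0 i)) ->
  forall i, measurable_fun setT (fun w => kstep c (Y w) ord0 i).
Proof.
move=> mY i; under eq_fun do rewrite kstepE !mxE.
apply: measurable_funB => //; apply: measurable_funM => //.
by apply: measurable_funM => //; exact: measurable_dotv.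
Qed.

(** The induction keeps [Y] general, since the first step replaces it by another vector with
    measurable coordinates. *)
Lemma measurable_Eidx_sqnorm n (C : 'M[R]_n) k (Y : T -> 'rV[R]_n) :
  (forall i, measurable_fun setT (fun w => Y w ord0 i)) ->
  measurable_fun setT (fun w => Eidx C (Y w) k (fun y => sqnorm y)).
Proof.
elim: k Y => [|k IH] Y mY.
  under eq_fun do rewrite Eidx0.
  by apply: measurable_sum => i; apply: measurable_funM.
under eq_fun do rewrite EidxS.
apply: measurable_sum => i; apply: measurable_funM => //.
by apply: (IH (fun w => kstep (row i C) (Y w))); exact: measurable_kstep.
Qed.

Variable P : probability T R.

(** Each side is the integral of the square against a pushforward law, and the two laws coincide. *)
Lemma integral_sqr_same_law (X Z : T -> R) :
  measurable_fun setT X -> measurable_fun setT Z ->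
  (forall B : set R, measurable B -> P [set w | B (X w)] = P [set w | B (Z w)]) ->
  \int[P]_w ((X w) ^+ 2)%:E = \int[P]_w ((Z w) ^+ 2)%:E.
Proof.
move=> mX mZ law.
have msq : measurable_fun [set: R] (fun t : R => (t ^+ 2)%:E).
  by apply/measurable_EFinP; apply: measurable_funX.
have push (V : T -> R) (mV : measurable_fun setT V) :
    \int[P]_w ((V w) ^+ 2)%:E = \int[pushforward P V]_t (t ^+ 2)%:E.
  rewrite (ge0_integral_pushforward mV) ?preimage_setT // => t _.
  by rewrite lee_fin sqr_ge0.
rewrite !push //; apply: eq_measure_integral => B mB _.
exact: law.
Qed.

(** Every coordinate has the same second moment as [dotv (Y w) u], and the [n] coordinate moments
    add up to [r ^+ 2]. *)
Lemma integral_dotv_sqr_uniform n (r : R) (Y : T -> 'rV[R]_n) (u : 'rV[R]_n) :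
  (0 < n)%N -> sqnorm u = 1%R -> uniform_on_sphere P r Y ->
  \int[P]_w ((dotv (Y w) u) ^+ 2)%:E = (r ^+ 2 / n%:R)%:E.
Proof.
move=> n0 u1 [mY Yr Yinv].
have coord i : \int[P]_w ((Y w ord0 i) ^+ 2)%:E = \int[P]_w ((dotv (Y w) u) ^+ 2)%:E.
  have [Q Qo QE] := exists_orthogonal_col i u1.
  apply: integral_sqr_same_law => //; first exact: measurable_dotv.
  move=> B mB.
  (* A box constrained only in coordinate [i] isolates the law of that coordinate. *)
  have := Yinv Q (fun j => if j == i then B else setT) Qo.
  have E (V : T -> 'rV[R]_n) :
      [set w | forall j : 'I_n, (if j == i then B else setT) (V w ord0 j)] =
      [set w | B (V w ord0 i)].
    apply/seteqP; split => w /=; first by move/(_ i); rewrite eqxx.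
    by move=> Bw j; case: eqP => [->|].
  rewrite !E => H; rewrite -H; last by move=> j; case: eqP.
  by congr (P _); apply/seteqP; split => w /=; rewrite QE.
set J := \int[P]_w _ in coord *.
have J0 : 0 <= J by apply: integral_ge0 => w _; rewrite lee_fin sqr_ge0.
have nJ : n%:R%:E * J = (r ^+ 2)%:E.
  transitivity (\sum_(i < n) J).
    by rewrite sumr_const card_ord mule_natl.
  under eq_bigr => i _ do rewrite -(coord i).
  rewrite -ge0_integral_sum //; last 2 first.
  - move=> i; apply/measurable_EFinP; exact: measurable_funX.
  - by move=> i w _; rewrite lee_fin sqr_ge0.
  transitivity (\int[P]_w (r ^+ 2)%:E); last first.
    by rewrite integral_cst //= probability_setT mule1.
  by apply: eq_integral => w _; rewrite sumEFin -(Yr w) normv_sqr.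
(* Nonnegativity excludes [-oo], and the finite total [r ^+ 2] excludes [+oo]. *)
case: J J0 nJ {coord} => [j||//] _.
  rewrite -EFinM => -[] <-; rewrite mulrC mulKf //; by rewrite pnatr_eq0 -lt0n.
by rewrite gt0_muley // lte_fin ltr0n.
Qed.

End Sphere.

(** * The conjugated matrix and its kernel vector *)

Section Setup.
Variables (R : realType) (n : nat) (A : 'M[R]_n) (lam : R) (x : 'cV[R]_n).
Hypothesis x_neq0 : forall i, x i 0 != 0.

Lemma Dmat_unit : Dmat x \in unitmx.
Proof.
rewrite unitmxE det_diag unitfE; apply/prodf_neq0 => i _.
by rewrite mxE normr_eq0.
Qed.

Lemma epsv_sqr i : epsv x 0 i ^+ 2 = 1.
Proof. by rewrite mxE sqr_sg x_neq0. Qed.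

(** [Dmat x] maps the sign vector to [x], so conjugation carries the eigenvector [x] of [A] to the
    sign vector. *)
Lemma Cmat_epsv : A *m x = lam *: x -> Cmat A lam x *m (epsv x)^T = 0.
Proof.
move=> Ax.
have De : Dmat x *m (epsv x)^T = x.
  apply/colP => i; rewrite mul_diag_mx !mxE mulrC -numEsg //.
have Dx : invmx (Dmat x) *m x = (epsv x)^T.
  by rewrite -[X in _ *m X]De mulKmx // Dmat_unit.
rewrite mulmxBl -mulmxA De -mulmxA Ax -scalemxAr Dx.
by rewrite mul_scalar_mx subrr.
Qed.

(** If [C = 0], then [Bmat A x] is scalar and the characteristic polynomial of [A] is a power of
    ['X - lam] with exponent [n > 1], against simplicity. *)
Lemma Cmat_neq0 : (1 < n)%N -> mup lam (char_poly A) = 1%N -> Cmat A lam x != 0.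
Proof.
move=> n1 mu; apply/eqP => /eqP; rewrite subr_eq0 => /eqP BE.
have Du := Dmat_unit.
move: mu; rewrite -(char_poly_conj A Du) -/(Bmat A x) BE.
rewrite char_poly_trig ?scalar_mx_is_trig //.
under eq_bigr => i _ do rewrite mxE eqxx mulr1n.
rewrite prodr_const card_ord mup_XsubCX eqxx => n1E.
by rewrite n1E in n1.
Qed.

End Setup.

(** * Contraction of the defect *)

Lemma kernel_defect_bound (R : realType) (n : nat) (C : 'M[R]_n)
  (e : 'rV[R]_n) (sv : seq R) (y : 'rV[R]_n) :
  (1 < n)%N -> C *m e^T = 0 -> e != 0 ->
  is_singular_values C sv -> 0 < sv`_(n - 2) ->
  sv`_(n - 2) ^+ 2 * (sqnorm e * sqnorm y - dotv y e ^+ 2)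
  <= sqnorm e * sqnorm (y *m C^T).
Proof.
(* With [n = m.+2], the zero-based index [n - 2] is [m], the place of sigma_(n-1). The spectral
   bound is then applied to [C^T *m C], whose eigenvalues are the squared singular values. *)
case: n C e y => [|[|m]] // C e y _ Ce e0 [sz so sp ch]; rewrite subn2 /= => s0.
pose s2 := [seq t ^+ 2 | t <- sv].
have s2m : s2`_m = sv`_m ^+ 2 by rewrite (nth_map 0) // sz.
have -> : sqnorm (y *m C^T) = (y *m (C^T *m C) *m y^T) 0 0.
  rewrite mulmxA -mulmxA (_ : C *m y^T = (y *m C^T)^T); last by rewrite trmx_mul trmxK.
  move: (y *m C^T) => z; rewrite mxE.
  by apply: eq_bigr => i _; rewrite mxE.
rewrite -s2m; apply: sym_second_eigenvalue_bound => //.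
- by rewrite trmx_mul trmxK.
- by rewrite ch big_map.
- by rewrite size_map.
- rewrite sorted_map; apply: (sub_in_sorted _ sp so) => a b a0 b0 ba.
  by rewrite /= ler_sqr.
- by rewrite s2m exprn_gt0.
- by rewrite mulmxA -[e *m C^T]trmxK trmx_mul trmxK Ce trmx0 mul0mx.
Qed.

Lemma dotv_row_kernel (R : realType) (n : nat) (C : 'M[R]_n) (e : 'rV[R]_n) i :
  C *m e^T = 0 -> dotv (row i C) e = 0.
Proof.
move/matrixP/(_ i 0); rewrite !mxE => H; rewrite -[RHS]H.
by apply: eq_bigr => j _; rewrite !mxE.
Qed.

Section Contraction.
Variables (R : realType) (n : nat) (C : 'M[R]_n) (e : 'rV[R]_n) (t : R).
Hypotheses (e_sg : forall i, e 0 i ^+ 2 = 1) (Ce : C *m e^T = 0) (C0 : C != 0).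
Hypothesis gap : forall y,
  t * (sqnorm e * sqnorm y - dotv y e ^+ 2) <= sqnorm e * sqnorm (y *m C^T).

Lemma sum_kstep_defect y :
  \sum_i pidx C i * (n%:R * sqnorm (kstep (row i C) y) - dotv (kstep (row i C) y) e ^+ 2)
  <= (1 - t / frob2 C) * (n%:R * sqnorm y - dotv y e ^+ 2).
Proof.
under eq_bigr => i _ do
  rewrite (dotv_kstep _ (dotv_row_kernel i Ce)) mulrBr mulrCA.
rewrite sumrB -mulr_sumr sum_kstep_sqnorm // -mulr_suml sum_pidx // mul1r.
have F0 : 0 < frob2 C by rewrite lt_neqAle eq_sym frob2_eq0 C0 frob2_ge0.
(* Since [sqnorm e = n], dividing [gap] by [frob2 C] gives exactly the required difference. *)
have := gap y; rewrite (sqnorm_signs e_sg) -(ler_pM2r (x := (frob2 C)^-1)) ?invr_gt0 //.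
move=> H; rewrite -subr_ge0 in H; rewrite -subr_ge0; apply: le_trans H _.
by rewrite le_eqVlt; apply/orP; left; apply/eqP; ring.
Qed.

(* The expected defect after one step is nonnegative, which forces the rate to be
   nonnegative as soon as the defect is positive somewhere. *)
Lemma rate_ge0 : (1 < n)%N -> 0 <= 1 - t / frob2 C.
Proof.
move=> n1; have n0 : (0 < n)%N by apply: ltn_trans n1.
(* A basis vector has defect [n - 1], positive because [1 < n]. *)
pose y : 'rV[R]_n := delta_mx 0 (Ordinal n0).
have y1 : sqnorm y = 1.
  rewrite /sqnorm /dotv (bigD1 (Ordinal n0)) //= big1 => [|j ji].
    by rewrite !mxE !eqxx mulr1 addr0.
  by rewrite !mxE (negPf ji) andbF mulr0.
have ye : dotv y e ^+ 2 = 1.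
  rewrite -(e_sg (Ordinal n0)) /dotv (bigD1 (Ordinal n0)) //= big1 => [|j ji].
    by rewrite !mxE !eqxx mul1r addr0.
  by rewrite !mxE (negPf ji) andbF mul0r.
have def : 0 < n%:R * sqnorm y - dotv y e ^+ 2.
  by rewrite y1 ye mulr1 subr_gt0 ltr1n.
rewrite -(pmulr_lge0 _ def); apply: le_trans (sum_kstep_defect y).
apply: sumr_ge0 => i _; rewrite mulr_ge0 ?pidx_ge0 // subr_ge0 mulrC.
by rewrite -(sqnorm_signs e_sg) dotv_sqr_le.
Qed.

Lemma Eidx_min_Sset_le k y : (1 < n)%N ->
  Eidx C y k (fun z => (minn #|Sset e z| (n - #|Sset e z|))%:R * sqnorm z)
  <= n%:R * (1 - t / frob2 C) ^+ k * sqnorm y.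
Proof.
move=> n1.
apply: le_trans (Eidx_mono _ _ _ (g := fun z => n%:R * sqnorm z - dotv z e ^+ 2) _) _.
  exact: min_Sset_le.
apply: le_trans (Eidx_contract (rate_ge0 n1) sum_kstep_defect k y) _.
(* The initial defect is at most [n%:R * sqnorm y]. *)
rewrite [leRHS]mulrAC [leRHS]mulrC ler_wpM2l ?exprn_ge0 ?rate_ge0 //.
by rewrite lerBlDr lerDl sqr_ge0.
Qed.

End Contraction.

(** * Lower bound and conclusion *)

Lemma Eidx_sqnorm_ge (R : realType) (n : nat) (C : 'M[R]_n) (u : 'rV[R]_n) k y :
  C != 0 -> C *m u^T = 0 -> sqnorm u = 1 ->
  dotv y u ^+ 2 <= Eidx C y k (fun z => sqnorm z).
Proof.
move=> C0 Cu u1.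
(* The squared component along [u] is conserved, so it equals its own expectation. *)
rewrite -(Eidx_invariant (f := fun z => dotv z u ^+ 2) k y C0); last first.
  by move=> i z; rewrite dotv_kstep ?dotv_row_kernel.
by apply: Eidx_mono => z; apply: le_trans (dotv_sqr_le _ _) _; rewrite u1 mulr1.
Qed.

Theorem mainTheorem1 (R : realType) (n : nat) (A : 'M[R]_n) (lam : R)
  (x : 'cV[R]_n) :
  (1 < n)%N ->
  mup lam (char_poly A) = 1%N ->
  A *m x = lam *: x ->
  (forall i, x i 0 != 0) ->
  let C := Cmat A lam x in
  let eps := epsv x in
  (forall sv : seq R, is_singular_values C sv -> 0 < sv`_(n - 2) ->
     forall (y0 : 'rV[R]_n), y0 != 0 -> forall k : nat,
       Eidx C y0 k (fun y => (minn #|Sset eps y| (n - #|Sset eps y|))%:R * sqnorm y)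
       <= n%:R * (1 - sv`_(n - 2) ^+ 2 / frob2 C) ^+ k * sqnorm y0)
  /\
  (forall (d : measure_display) (T : measurableType d) (P : probability T R)
     (r : R) (Y0 : T -> 'rV[R]_n),
     0 < r -> uniform_on_sphere P r Y0 -> forall k : nat,
     ((r ^+ 2 / n%:R)%:E <= \int[P]_(w in setT) (Eidx C (Y0 w) k (fun y => sqnorm y))%:E)%E).
Proof.
move=> n1 simple Ax x0 C eps.
have C0 : C != 0 by apply: Cmat_neq0.
have Ce : C *m eps^T = 0 by apply: Cmat_epsv.
have sg := epsv_sqr x0.
have n0 : (0 < n)%N by apply: ltn_trans n1.
have e0 : eps != 0.
  by rewrite -sqnorm_eq0 (sqnorm_signs sg) pnatr_eq0 -lt0n.
split=> [sv svC sv0 y0 _ k|d T P r Y0 _ unif k].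
  by apply: Eidx_min_Sset_le => // y; apply: kernel_defect_bound.
pose u := (normv eps)^-1 *: eps.
have u1 : sqnorm u = 1.
  rewrite /sqnorm dotvZl dotvC dotvZl mulrA -expr2 exprVn normv_sqr mulVf //.
  by rewrite sqnorm_eq0.
have Cu : C *m u^T = 0 by rewrite linearZ /= -scalemxAr Ce scaler0.
rewrite -(integral_dotv_sqr_uniform n0 u1 unif); case: unif => mY _ _.
apply: ge0_le_integral => //.
- by move=> w _; rewrite lee_fin sqr_ge0.
- apply/measurable_EFinP/measurable_funX; exact: measurable_dotv.
- apply/measurable_EFinP; exact: measurable_Eidx_sqnorm.
- by move=> w _; rewrite lee_fin; apply: Eidx_sqnorm_ge.
Qed.
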